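(* If $G$ is a disjoint union of cliques (i.e. every connected component of $G$ is a complete graph) and the largest component of $G$ has $t$ vertices, then $\chi_{pc}(G) = t$.
   Context: All graphs are finite and simple, with at least one vertex. Let $k$ be a positive integer. A $k$-assignment $L$ for a graph $G$ assigns to each vertex $v$ a set $L(v)$ of exactly $k$ colors; its palette is $\mathcal{L} = \bigcup_{v \in V(G)} L(v)$, and for $c \in \mathcal{L}$, $\eta(c) = |\{v \in V(G) : c \in L(v)\}|$. A proper $L$-coloring of $G$ is a proper coloring $f$ of $G$ with $f(v) \in L(v)$ for every vertex $v$. It is a proportional $L$-coloring if for every $c \in \mathcal{L}$, $|f^{-1}(c)|$ equals $\lfloor \eta(c)/k \rfloor$ or $\lceil \eta(c)/k \rceil$. $G$ is proportionally $k$-choosable if a proportional $L$-coloring of $G$ exists for every $k$-assignment $L$ for $G$. The proportional choice number $\chi_{pc}(G)$ is the smallest positive integer $k$ such that $G$ is proportionally $k$-choosable. *)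

(* Defs.v *)
From mathcomp Require Import all_boot.

Set Implicit Arguments.
Unset Strict Implicit.
Unset Printing Implicit Defensive.

Record sgraph := SGraph {
  vertex :> finType;
  adj : rel vertex;
  adj_sym : symmetric adj;
  adj_irr : irreflexive adj
}.

Definition components (G : sgraph) : {set {set G}} :=
  equivalence_partition (connect (@adj G)) [set: G].

Definition disjoint_union_of_cliques (G : sgraph) : Prop :=
  forall A : {set G}, A \in components G ->
  forall x y : G, x \in A -> y \in A -> x != y -> adj x y.

Definition largest_component_order (G : sgraph) : nat :=
  \max_(A in components G) #|A|.

(* The ceiling of m / k, for k > 0. *)
Definition ceil_divn (m k : nat) : nat := (m + k.-1) %/ k.

Lemma ceil_divnP (m k q : nat) : 0 < k -> (ceil_divn m k <= q) = (m <= q * k).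
Proof.
by case: k => // k _; rewrite /ceil_divn -ltnS ltn_divLR // mulSn /= addnC addSn ltnS leq_add2l.
Qed.

Definition is_k_assignment (G : sgraph) (C : finType) (k : nat)
  (L : G -> {set C}) : Prop := forall v : G, #|L v| = k.

Definition palette (G : sgraph) (C : finType) (L : G -> {set C}) : {set C} :=
  \bigcup_(v : G) L v.

Definition eta (G : sgraph) (C : finType) (L : G -> {set C}) (c : C) : nat :=
  #|[set v : G | c \in L v]|.

Definition proper_coloring (G : sgraph) (C : finType) (f : G -> C) : Prop :=
  forall x y : G, adj x y -> f x <> f y.

Definition proper_list_coloring (G : sgraph) (C : finType) (L : G -> {set C})
  (f : G -> C) : Prop :=
  proper_coloring f /\ forall v : G, f v \in L v.

Definition proportional_coloring (G : sgraph) (C : finType) (k : nat)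
  (L : G -> {set C}) (f : G -> C) : Prop :=
  proper_list_coloring L f /\
  forall c : C, c \in palette L ->
    #|f @^-1: [set c]| = eta L c %/ k \/
    #|f @^-1: [set c]| = ceil_divn (eta L c) k.

(* Colors come from an arbitrary finite type. This is no restriction, as the
   palette of an assignment on a finite graph is finite. *)
Definition proportionally_choosable (G : sgraph) (k : nat) : Prop :=
  forall (C : finType) (L : G -> {set C}), is_k_assignment k L ->
  exists f : G -> C, proportional_coloring k L f.

Definition is_proportional_choice_number (G : sgraph) (k : nat) : Prop :=
  [/\ 0 < k, proportionally_choosable G k &
      forall j : nat, 0 < j -> proportionally_choosable G j -> k <= j].

(* Main.v *)
Require Import Defs.
From mathcomp Require Import all_boot all_fingroup zify.

(* Upper bound. Let every list have size t. Enumerating the lists splits the pairs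
   (v, c) with c in L(v) into t colorings, each choosing one color per vertex.
   Among all such decompositions take one minimizing the sum, over the colorings
   and the pairs (B, c) with B either the whole graph or a component, of the square
   of the number of vertices of B colored c. If two of the colorings differed by 2
   or more on some (B, c), then exchanging them on a suitable set of vertices would
   balance them on all pairs (B, c) simultaneously and decrease the sum. Hence at
   the minimum the t counts on each (B, c) are pairwise within 1. For B a component
   they add up to at most |B| <= t, so each is at most 1 and every coloring is
   proper; for B the whole graph they add up to eta(c), so each is the floor or the
   ceiling of eta(c)/t.
   Lower bound. When all lists are equal, a component of size t needs t colors. *)

(** * Two-colorings that alternate along two involutions *)

(* The group generated by s and t acts on each of its orbits as a dihedral group,
   whose rotations [t \o s] have two orbits there, swapped by both s and t. *)
Lemma alternating_coloring_fixfree {X : finType} (s t : X -> X) :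
  involutive s -> involutive t ->
  (forall x, s x != x) -> (forall x, t x != x) ->
  exists h : X -> bool, forall x, h (s x) = ~~ h x /\ h (t x) = ~~ h x.
Proof.
move=> sK tK s_ff t_ff.
pose r := (perm (can_inj sK) * perm (can_inj tK))%g.
have rE x : r x = t (s x) by rewrite permM !permE.
have rsE x : r (s x) = t x by rewrite rE sK.
have rsr x : r (s (r x)) = s x by rewrite rsE rE tK.
have rnsrn n x : (r ^+ n)%g (s ((r ^+ n)%g x)) = s x.
  rewrite !permX; elim: n x => //= n IHn x.
  by rewrite -iterS iterSr rsr IHn.
(* If [s x] were [r^n x] with [n = 2m + e], the relation [r^m s r^m = s] would give [s y = r^e y]
   for [y = r^m x]: a fixed point of [s] if [e = 0], of [t] if [e = 1]. *)
have s_out x : s x \notin porbit r x.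
  apply/negP => /porbitP [n].
  rewrite -(odd_double_half n) -addnn => En.
  have /perm_inj : (r ^+ n./2)%g (s ((r ^+ n./2)%g x)) =
      (r ^+ n./2)%g ((r ^+ (odd n))%g ((r ^+ n./2)%g x)).
    by rewrite rnsrn En -!permM -!expgD; congr ((r ^+ _)%g x); lia.
  set y := (r ^+ _)%g x; case: (odd n); last first.
    by rewrite expg0 perm1 => /eqP; apply/negP.
  by rewrite expg1 rE => /esym/eqP; apply/negP.
(* Ranking the rotation orbits breaks the symmetry: of two orbits swapped by [s], the lower one gets
   the value true. *)
pose k x := enum_rank (porbit r x).
have k_neq x : val (k (s x)) != val (k x).
  rewrite (inj_eq val_inj) (inj_eq enum_rank_inj) eq_sym eq_porbit_mem porbit_sym.
  exact: s_out.
have k_r x : k (r x) = k x.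
  congr enum_rank; apply/eqP; rewrite eq_porbit_mem.
  by rewrite -{1}[r]expg1 mem_porbit.
have k_t x : k (t x) = k (s x) by rewrite -rsE k_r.
have k_st x : k (s (t x)) = k x by rewrite -[in RHS](tK x) -(sK (t x)) -rE k_r sK.
exists (fun x => k x < k (s x)) => x; rewrite k_t k_st sK.
by rewrite -leqNgt ltn_neqAle k_neq.
Qed.

Lemma alternating_coloring {X : finType} (s t : X -> X) :
  involutive s -> involutive t -> (forall x, s x != x) ->
  exists h : X -> bool,
    forall x, h (s x) = ~~ h x /\ (t x != x -> h (t x) = ~~ h x).
Proof.
move=> sK tK s_ff.
(* On two copies of [X], swapping the copies of a fixed point of [t] removes it. *)
pose s2 (z : X * bool) := (s z.1, z.2).
pose t2 (z : X * bool) := if t z.1 == z.1 then (z.1, ~~ z.2) else (t z.1, z.2).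
have [||||h hP] := @alternating_coloring_fixfree (X * bool)%type s2 t2.
- by case=> x b; rewrite /s2 /= sK.
- case=> x b; rewrite /t2 /=; have [e|tx] := eqVneq (t x) x => /=.
    by rewrite e eqxx negbK.
  by rewrite tK eq_sym (negbTE tx).
- by case=> x b; rewrite /s2 xpair_eqE /= negb_and s_ff.
- case=> x b; rewrite /t2 /=; case: ifPn => tx; rewrite xpair_eqE negb_and ?tx //.
  by case: b; rewrite orbT.
exists (fun x => h (x, false)) => x; have [<- ht] := hP (x, false); split=> // tx.
by rewrite -ht /t2 /= (negbTE tx).
Qed.

(** * Partial matchings and the balance they force *)

(* List each fiber and match the entries in positions 2i and 2i + 1. *)
Lemma fiber_pairing {X : finType} {T : eqType} (f : X -> T) (S : {set X}) :
  exists t : X -> X,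
    [/\ involutive t, forall x, f (t x) = f x, forall x, x \notin S -> t x = x &
        forall x y, x \in S -> y \in S -> f x = f y -> t x = x -> t y = y -> x = y].
Proof.
pose F x := enum [set y in S | f y == f x].
have memF x y : (y \in F x) = (y \in S) && (f y == f x) by rewrite mem_enum inE.
have F_eq x y : f x = f y -> F x = F y by rewrite /F => ->.
have uF x : uniq (F x) by exact: enum_uniq.
pose j i := if odd i then i.-1 else i.+1.
have jK i : j (j i) = i.
  rewrite /j; case: (boolP (odd i)) => [|/= ->] //.
  by case: i => //= i /negbTE ->.
have j_neq i : j i <> i by case: i => // i; rewrite /j; case: ifP; lia.
(* The default [x] makes the last entry of a list of odd length a fixed point. *)
pose t x := nth x (F x) (j (index x (F x))).
pose t' x := if x \in S then t x else x.
have tP x : x \in S ->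
    [/\ t x \in F x, j (index x (F x)) < size (F x) & index (t x) (F x) = j (index x (F x))]
    \/ size (F x) = (index x (F x)).+1 /\ t x = x.
  move=> xS; have xF : x \in F x by rewrite memF xS eqxx.
  have := xF; rewrite -index_mem /t => ix.
  case: (ltnP (j (index x (F x))) (size (F x))) => [lt_j|le_j].
    by left; split=> //; [exact: mem_nth | exact: index_uniq].
  right; rewrite nth_default //; split=> //.
  by move: le_j ix; rewrite /j; move: (size _) (index _ _) => m i; case: ifP; lia.
have ft x : f (t' x) = f x.
  rewrite /t'; case: ifP => // xS.
  by case: (tP x xS) => [[]|[_ -> //]]; rewrite memF => /andP[_ /eqP].
exists t'; split=> //.
- move=> x; rewrite {2}/t'; case: ifP => xS; last by rewrite /t' xS.
  case: (tP x xS) => [[txF _ it]|[_ tx]]; last by rewrite tx /t' xS tx.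
  have := txF; rewrite memF => /andP[txS /eqP /F_eq Ftx].
  by rewrite /t' txS {1}/t Ftx it jK nth_index // memF xS eqxx.
- by move=> x /negbTE xS; rewrite /t' xS.
- move=> x y xS yS fxy; rewrite /t' xS yS => tx ty.
  have szF z : z \in S -> t z = z -> size (F z) = (index z (F z)).+1.
    by move=> zS tz; case: (tP z zS) => [[_ _]|[] //]; rewrite tz => /esym/j_neq.
  have := szF x xS tx; rewrite (F_eq x y fxy) (szF y yS ty) => -[] e.
  have xF : x \in F y by rewrite memF xS fxy eqxx.
  have yF : y \in F y by rewrite memF yS eqxx.
  by rewrite -(nth_index x xF) -e nth_index.
Qed.

(** The set [U] of points without a partner inside [K] has at most one element; on the rest of [K],
    [t] injects the points where [h] holds into those where it fails. *)
Lemma matched_balance {X : finType} (t : X -> X) (h : X -> bool) (K : {set X}) :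
  involutive t ->
  (forall x, t x != x -> h (t x) = ~~ h x) ->
  (forall x y, x \in K -> y \in K -> (t x \in K -> t x = x) ->
     (t y \in K -> t y = y) -> x = y) ->
  #|[set x in K | h x]| <= #|[set x in K | ~~ h x]|.+1.
Proof.
move=> tK ht K1.
pose U := [set x in K | (t x \in K) ==> (t x == x)].
have U1 : #|U| <= 1.
  apply/card_le1P => x; rewrite inE => /andP[xK /implyP xU] y.
  rewrite !inE; apply/idP/eqP => [/andP[yK /implyP yU]|->]; last exact/andP/(conj xK)/implyP.
  by apply/eqP; rewrite eq_sym; apply/eqP/K1 => // [/xU|/yU] /eqP.
rewrite -(cardsID U) -add1n leq_add //.
  by rewrite (leq_trans _ U1) // subset_leq_card // subsetIr.
rewrite -(card_imset _ (inv_inj tK)) subset_leq_card //.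
apply/subsetP => _ /imsetP[x + ->]; rewrite !inE => /andP[+ /andP[xK hx]].
by rewrite xK negb_imply /= => /andP[-> /ht ->]; rewrite hx.
Qed.

(** * Balanced exchange between two colorings *)

Definition color_count {V : finType} {C : eqType} (B : {set V}) (p : V -> C) (c : C) :=
  #|[set v in B | p v == c]|.

(** [None] encodes the whole vertex set, so that global and componentwise counts are handled by the
    same statements. *)
Definition fiber_block {V : finType} {T : eqType} (comp : V -> T) (o : option T) : {set V} :=
  if o is Some a then [set v | comp v == a] else setT.

(* Each vertex is an edge joining its two colors; balancing means orienting these
   edges so that in- and out-degrees differ by at most one on all blocks at once. *)
Lemma balanced_swap {V : finType} {T C : eqType} (comp : V -> T) (p q : V -> C) :
  exists w : V -> bool, forall o c,
    let np := color_count (fiber_block comp o) (fun v => if w v then q v else p v) c in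
    let nq := color_count (fiber_block comp o) (fun v => if w v then p v else q v) c in
    np <= nq.+1 /\ nq <= np.+1.
Proof.
(* The half-edges of [v] are [(v, false)], at color [p v], and [(v, true)], at color [q v]. *)
pose key (x : V * bool) := if x.2 then q x.1 else p x.1.
(* Match half-edges first by fiber and color, then the leftovers by color alone. *)
have [t1 [t1K t1key _ t1_fix]] :=
  fiber_pairing (fun x : V * bool => (comp x.1, key x)) setT.
pose S := [set x | t1 x == x].
have [t2 [t2K t2key t2S t2_fix]] := fiber_pairing key S.
pose t x := if x \in S then t2 x else t1 x.
have t2in x : x \in S -> t2 x \in S.
  move=> xS; apply/idPn => /[dup] nS /t2S; rewrite t2K => e.
  by rewrite -e xS in nS.
have t1in x : x \notin S -> t1 x \notin S.
  by rewrite !inE t1K eq_sym.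
have tK : involutive t.
  move=> x; rewrite {2}/t; case: ifPn => xS; rewrite /t.
    by rewrite t2in // t2K.
  by rewrite (negbTE (t1in x xS)) t1K.
have key_t1 x : key (t1 x) = key x by case: (t1key x).
have key_t x : key (t x) = key x by rewrite /t; case: ifP.
pose s (x : V * bool) := (x.1, ~~ x.2).
have [h hP] : exists h : V * bool -> bool,
    forall x, h (s x) = ~~ h x /\ (t x != x -> h (t x) = ~~ h x).
  apply: alternating_coloring tK _ => -[v b]; first by rewrite /s negbK.
  by rewrite /s xpair_eqE eqxx; case: b.
(* Chosen so that the first new coloring reads, at each vertex, the half-edge where [h] is true, and
   the second the one where it is false. *)
pose w v := ~~ h (v, false).
have hw v b : h (v, w v (+) b) = ~~ b.
  have [+ _] := hP (v, false); rewrite /s /= => ht.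
  rewrite /w; case E: (h (v, false)); case: b => //=; by rewrite ?ht E.
pose K o c := [set x : V * bool | (x.1 \in fiber_block comp o) && (key x == c)].
(* A half-edge unmatched inside [K o c] is fixed by [t1], which preserves fiber and color. Each
   fiber has at most one such half-edge per color; on all of [V], [t2] pairs these leftovers and at
   most one remains. *)
have K1 o c x y : x \in K o c -> y \in K o c -> (t x \in K o c -> t x = x) ->
    (t y \in K o c -> t y = y) -> x = y.
  have fix1 z : z \in K o c -> (t z \in K o c -> t z = z) -> t1 z = z.
    move=> zK; rewrite /t; case: ifPn => [|_]; first by rewrite inE => /eqP.
    apply; move: zK; rewrite !inE key_t1 => /andP[+ ->].
    by case: o => [a|]; rewrite !inE //; case: (t1key z) => ->; rewrite andbT.
  move=> xK yK xf yf; have x1 := fix1 x xK xf; have y1 := fix1 y yK yf.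
  have xS : x \in S by rewrite inE x1.
  have yS : y \in S by rewrite inE y1.
  move: xK yK xf yf; rewrite /t xS yS !inE !t2key => /andP[xo /eqP xc] /andP[yo /eqP yc].
  case: o xo yo {fix1} => [a|]; rewrite !inE xc yc eqxx.
    by move=> /eqP xa /eqP ya _ _; apply: t1_fix; rewrite ?inE // xc yc xa ya.
  by move=> _ _ xf yf; apply: t2_fix; rewrite ?xc ?yc ?xf ?yf.
have countE b o c : color_count (fiber_block comp o) (fun v => key (v, w v (+) b)) c =
    #|[set x in K o c | h x == ~~ b]|.
  rewrite /color_count -(card_imset _ (f := fun v => (v, w v (+) b))); last by move=> u v [].
  apply: eq_card => -[v b']; rewrite !inE /=; apply/imsetP/andP.
    by case=> u; rewrite inE => uP [-> ->]; rewrite hw.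
  case=> vP /eqP hb; have eb : b' = w v (+) b.
    move: hb; have := hw v (~~ b); rewrite addbN.
    by case: (w v (+) b); case: b' {vP} => //= ->; case: b.
  by exists v; [rewrite inE /= -eb | rewrite /= -eb].
exists w => o c np nq.
have -> : np = #|[set x in K o c | h x]|.
  transitivity (color_count (fiber_block comp o) (fun v => key (v, w v (+) false)) c).
    by apply: eq_card => v; rewrite !inE /key addbF.
  by rewrite countE; apply: eq_card => x; rewrite !inE eqb_id.
have -> : nq = #|[set x in K o c | ~~ h x]|.
  transitivity (color_count (fiber_block comp o) (fun v => key (v, w v (+) true)) c).
    by apply: eq_card => v; rewrite !inE /key addbT /=; case: (w v).
  by rewrite countE; apply: eq_card => x; rewrite !inE eqbF_neg.
split; first exact: matched_balance tK (fun x => (hP x).2) (K1 o c).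
have -> : #|[set x in K o c | h x]| = #|[set x in K o c | ~~ ~~ h x]|.
  by apply: eq_card => x; rewrite !inE negbK.
by apply: (matched_balance t (fun x => ~~ h x)) (K1 o c) => // x /(hP x).2 ->.
Qed.

(** * Sums of squares under balancing *)

(** With [e = m' - m] and [d = n' - m'], the sum of squares drops by exactly [2e(e + d)]. *)
Lemma sum_squares_narrow (m n m' n' : nat) :
  m <= m' -> m' <= n' -> m' + n' = m + n ->
  m' ^ 2 + n' ^ 2 <= m ^ 2 + n ^ 2 /\ (m < m' -> m' ^ 2 + n' ^ 2 < m ^ 2 + n ^ 2).
Proof.
move=> /subnKC; move: (m' - m) => e <- /subnKC; move: (n' - _) => d <-.
rewrite -addnA => /addnI <-.
have -> : m ^ 2 + (e + (m + e + d)) ^ 2 =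
    (m + e) ^ 2 + (m + e + d) ^ 2 + (e * (e + d)).*2 by lia.
rewrite leq_addr; split=> // lt_e.
by rewrite -[ltnLHS]addn0 ltn_add2l double_gt0 muln_gt0 addn_gt0; lia.
Qed.

Lemma sum_squares_balance {I : finType} (F F' : I -> nat) (a b : I) :
  a != b -> (forall i, i != a -> i != b -> F' i = F i) ->
  \sum_i F' i = \sum_i F i -> F' a <= (F' b).+1 -> F' b <= (F' a).+1 ->
  \sum_i F' i ^ 2 <= \sum_i F i ^ 2 /\
  ((F b).+1 < F a -> \sum_i F' i ^ 2 < \sum_i F i ^ 2).
Proof.
move=> ab FF'.
have split2 (f : I -> nat) :
    \sum_i f i = f a + (f b + \sum_(i | (i != a) && (i != b)) f i).
  by rewrite (bigD1 a) //= (bigD1 b) //= eq_sym.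
rewrite !split2.
have -> : \sum_(i | (i != a) && (i != b)) F' i = \sum_(i | (i != a) && (i != b)) F i.
  by apply: eq_bigr => i /andP[ia ib]; rewrite FF'.
have -> : \sum_(i | (i != a) && (i != b)) F' i ^ 2 =
    \sum_(i | (i != a) && (i != b)) F i ^ 2.
  by apply: eq_bigr => i /andP[ia ib]; rewrite FF'.
move: (F a) (F b) (F' a) (F' b) (\sum_(i | _) _) (\sum_(i | _) _) => x y x' y' s r.
rewrite !addnA => /addIn sumE; rewrite !leq_add2r ltn_add2r => h1 h2.
(* Each pair is sorted so that [sum_squares_narrow] applies; a new pair within 1 of equal is nested
   in the old one. *)
have [xy|yx] := leqP x y; have [xy'|yx'] := leqP x' y'.
- have [|-> lt] := sum_squares_narrow x y x' y' _ xy' sumE; first by lia.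
  by split=> // lt_yx; apply: lt; lia.
- rewrite [x' + y']addnC [x' ^ 2 + _]addnC in sumE *.
  have [|-> lt] := sum_squares_narrow x y y' x' _ (ltnW yx') sumE; first by lia.
  by split=> // lt_yx; apply: lt; lia.
- rewrite [x + y]addnC [x ^ 2 + _]addnC in sumE *.
  have [|-> lt] := sum_squares_narrow y x x' y' _ xy' sumE; first by lia.
  by split=> // lt_yx; apply: lt; lia.
- rewrite [x + y]addnC [x' + y']addnC [x ^ 2 + _]addnC [x' ^ 2 + _]addnC in sumE *.
  have [|-> lt] := sum_squares_narrow y x y' x' _ (ltnW yx') sumE; first by lia.
  by split=> // lt_yx; apply: lt; lia.
Qed.

(** * Decompositions of a list assignment into colorings *)

Section Decomposition.

Context {V T C : finType} {k : nat} {L : V -> {set C}}.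
Hypothesis cardL : forall v, #|L v| = k.

Local Notation system := {ffun 'I_k -> {ffun V -> C}}.

Definition decomposition (g : system) : bool :=
  [forall v, injectiveb (fun i => g i v) && [forall i, g i v \in L v]].

Lemma decompositionP (g : system) :
  reflect ((forall v, injective (fun i => g i v)) /\ forall v i, g i v \in L v)
    (decomposition g).
Proof.
apply: (iffP forallP) => [gP|[g_inj gL] v].
  by split=> v; have /andP[/injectiveP ? /forallP ?] := gP v.
by apply/andP; split; [exact/injectiveP | exact/forallP].
Qed.

Lemma decomposition_exists : exists g : system, decomposition g.
Proof.
exists [ffun i => [ffun v => enum_val (cast_ord (esym (cardL v)) i)]].
apply/decompositionP; split=> v; last by move=> i; rewrite !ffunE enum_valP.
by move=> i j; rewrite !ffunE => /enum_val_inj /cast_ord_inj.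
Qed.

(** Double counting: as [L v] has [k] elements, the [k] distinct colors given to [v] are exactly
    those of [L v], each used once. *)
Lemma sum_color_count (g : system) (B : {set V}) c : decomposition g ->
  \sum_i color_count B (g i) c = #|[set v in B | c \in L v]|.
Proof.
move=> /decompositionP[g_inj gL].
have cardE (P : pred V) : #|[set v in B | P v]| = \sum_(v in B) P v.
  rewrite -sum1_card big_mkcond [RHS]big_mkcond; apply: eq_bigr => v _.
  by rewrite !inE; case: (v \in B) (P v) => [] [].
rewrite cardE; under eq_bigr => i _ do rewrite /color_count cardE.
rewrite exchange_big /=; apply: eq_bigr => v _.
have imL : [set g i v | i : 'I_k] = L v.
  apply/eqP; rewrite eqEcard card_imset // cardL card_ord leqnn andbT.
  by apply/subsetP => _ /imsetP[i _ ->].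
rewrite -imL; case: imsetP => [[j _ ->]|nc].
  rewrite (bigD1 j) //= eqxx big1 // => i; rewrite -(inj_eq (g_inj v)).
  by move=> /negbTE ->.
by rewrite big1 // => i _; case: eqP => // e; case: nc; exists i.
Qed.

Definition energy (comp : V -> T) (g : system) : nat :=
  \sum_(z : option T * C) \sum_i color_count (fiber_block comp z.1) (g i) z.2 ^ 2.

Lemma balanced_decomposition (comp : V -> T) :
  exists2 g, decomposition g & forall o c i j,
    color_count (fiber_block comp o) (g i) c <= (color_count (fiber_block comp o) (g j) c).+1.
Proof.
have [g0 g0P] := decomposition_exists.
case: (arg_minnP (energy comp) g0P) => g gP g_min; exists g => // o c a b.
rewrite leqNgt; apply/negP => unbal.
have ab : a != b by apply: contraTneq unbal => ->; rewrite -leqNgt leqnSn.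
have [w wP] := balanced_swap comp (g a) (g b).
(* Exchanging two colorings at [v] permutes the indices there, so the colors at [v] remain distinct
   and in [L v]. *)
pose g' := [ffun i => [ffun v => g (if w v then tperm a b i else i) v]].
have g'P : decomposition g'.
  have /decompositionP[g_inj gL] := gP.
  apply/decompositionP; split=> v; last by move=> i; rewrite !ffunE.
  by move=> i j; rewrite !ffunE => /g_inj; case: (w v) => // /perm_inj.
have countE (B : {set V}) (p q : V -> C) x : p =1 q -> color_count B p x = color_count B q x.
  by move=> pq; apply: eq_card => v; rewrite !inE pq.
have g'a : g' a =1 (fun v => if w v then g b v else g a v).
  by move=> v; rewrite !ffunE tpermL; case: (w v).
have g'b : g' b =1 (fun v => if w v then g a v else g b v).
  by move=> v; rewrite !ffunE tpermR; case: (w v).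
pose F h (z : option T * C) (i : 'I_k) :=
  color_count (fiber_block comp z.1) (h i : {ffun V -> C}) z.2.
have decr z : \sum_i F g' z i ^ 2 <= \sum_i F g z i ^ 2 /\
    ((F g z b).+1 < F g z a -> \sum_i F g' z i ^ 2 < \sum_i F g z i ^ 2).
  have := wP z.1 z.2; rewrite -(countE _ _ _ _ g'a) -(countE _ _ _ _ g'b) => -[le1 le2].
  apply: sum_squares_balance ab _ _ le1 le2; last by rewrite !sum_color_count.
  by move=> i ia ib; apply: countE => v; rewrite !ffunE tpermD 1?eq_sym ?if_same.
suff: energy comp g' < energy comp g by rewrite ltnNge g_min.
rewrite /energy (bigD1 (o, c)) //= [ltnRHS](bigD1 (o, c)) //= -addSn leq_add //.
  exact: (decr (o, c)).2.
by apply: leq_sum => z _; exact: (decr z).1.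
Qed.

End Decomposition.

(** * From balanced counts to the proportional choice number *)

(** If [F i] exceeds some value, all values are [F i - 1] or [F i], and the mean rounds up to [F i].
    Otherwise all are [F i] or [F i + 1], with [F i] attained, and the mean rounds down to [F i]. *)
Lemma balanced_member {k : nat} (F : 'I_k -> nat) (i : 'I_k) :
  (forall a b, F a <= (F b).+1) ->
  F i = (\sum_a F a) %/ k \/ F i = ceil_divn (\sum_a F a) k.
Proof.
move=> bal; have k0 : 0 < k by case: k i {F bal} => // -[].
have sumE (m : nat) : \sum_(a < k) m = k * m by rewrite sum_nat_const card_ord.
case: (boolP [exists j, F j < F i]) => [/existsP[j ji]|/existsPn ge].
  right; apply/eqP; rewrite eqn_leq ceil_divnP // andbC; apply/andP; split.
    by rewrite mulnC -sumE; apply: leq_sum => a _; rewrite (leq_trans (bal a j)).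
  rewrite -(ltn_predK ji) ltnNge ceil_divnP // -ltnNge mulnC -sumE.
  rewrite (bigD1 i) //= [ltnRHS](bigD1 i) //= -addSn (ltn_predK ji) leq_add2l.
  by apply: leq_sum => a _; rewrite -ltnS (ltn_predK ji).
left; apply/eqP; rewrite eqn_leq leq_divRL //; apply/andP; split.
  by rewrite mulnC -sumE; apply: leq_sum => a _; rewrite leqNgt ge.
rewrite -ltnS ltn_divLR // mulnC -sumE (bigD1 i) //= [ltnRHS](bigD1 i) //= -addSn leq_add //.
by apply: leq_sum => a _.
Qed.

Lemma connect_component {G : sgraph} (x : G) :
  [set y | connect (@adj G) x y] \in components G.
Proof.
apply/imsetP; exists x; rewrite ?inE //.
by apply/setP => y; rewrite !inE.
Qed.

Theorem corollary10 (G : sgraph) (t : nat) :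
  0 < #|G| ->
  disjoint_union_of_cliques G ->
  largest_component_order G = t ->
  is_proportional_choice_number G t.
Proof.
move=> G0 cliques <-.
set t' := largest_component_order G.
have csym : connect_sym (@adj G) by apply: sym_connect_sym; exact: adj_sym.
have le_t (A : {set G}) : A \in components G -> #|A| <= t'.
  by move=> AP; apply: (bigmax_sup A).
have t0 : 0 < t'.
  have /card_gt0P[x _] := G0.
  apply: leq_trans (le_t _ (connect_component x)).
  by apply/card_gt0P; exists x; rewrite inE connect0.
split=> //.
- move=> C L cardL.
  have [g /[dup] gP /decompositionP[_ gL] bal] :=
    balanced_decomposition cardL (root (@adj G)).
  pose i0 := Ordinal t0.
  exists (g i0); split; last first.
    move=> c _; have setT_E : #|[set v in fiber_block (root (@adj G)) None | c \in L v]| = eta L c.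
      by apply: eq_card => v; rewrite !inE.
    rewrite -setT_E -(sum_color_count cardL _ _ c gP).
    have countE : #|g i0 @^-1: [set c]| = color_count [set: G] (g i0) c.
      by apply: eq_card => v; rewrite !inE.
    rewrite countE; exact: balanced_member i0 (fun a b => bal None c a b).
  split=> // x y xy fxy.
  set A := [set z | connect (@adj G) x z].
  have AE : fiber_block (root (@adj G)) (Some (root (@adj G) x)) = A.
    by apply/setP => z; rewrite !inE root_connect // csym.
  (* A count of at least 2 in one coloring makes all [t'] counts positive, so their sum exceeds
     [t'], although it is at most [#|A| <= t']. *)
  have gt1 : 1 < color_count A (g i0) (g i0 x).
    apply/card_gt1P; exists x, y; split; rewrite ?inE ?connect0 ?eqxx //.
    - by rewrite connect1 // fxy eqxx.
    - by apply: contraTneq xy => ->; rewrite adj_irr.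
  have ge1 i : 0 < color_count A (g i) (g i0 x).
    by rewrite -ltnS (leq_trans gt1) // -AE bal.
  have := le_t _ (connect_component x); rewrite -/A leqNgt => /negP; apply.
  have le_A : \sum_i color_count A (g i) (g i0 x) <= #|A|.
    rewrite (sum_color_count cardL _ _ _ gP) subset_leq_card //.
    by apply/subsetP => z; rewrite inE => /andP[].
  apply: leq_trans le_A; rewrite -[t' in t' < _]card_ord -sum1_card.
  rewrite (bigD1 i0) //= [ltnRHS](bigD1 i0) //= -addSn leq_add //.
  by apply: leq_sum => i _.
- move=> j j0 jch; apply/bigmax_leqP => A AP.
  (* With every list equal to all of ['I_j], a proper coloring is injective on the clique [A]. *)
  have [v|f [[f_proper _] _]] := jch 'I_j (fun=> setT).
    by rewrite cardsT card_ord.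
  rewrite -[j]card_ord -(card_in_imset (f := f) (D := A)) ?max_card //.
  move=> x y xA yA fxy; apply/eqP/negPn/negP => /(cliques A AP x y xA yA) /f_proper.
  exact.
Qed.
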